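(* Let $P>0$, $Q>0$, and let $C$ be the capacity of the dirty paper channel with phase fading with input power constraint $P$, interference power $Q$, and phase $\theta$ uniformly distributed on $[0,2\pi)$. Then for every $\alpha\in[0,1]$, writing $\bar\alpha=1-\alpha$, $$ C\ \ge\ \tfrac12\log(1+Q+\alpha P)-\tfrac12\log(1+Q)+\tfrac12\log(\bar\alpha P+1)-3 . $$
   Context: Dirty paper channel with phase fading (DPC-PF): for channel uses $j=1,\dots,N$ the (complex) output is $Y_j=X_j+e^{i\theta_j}S_{Rj}+Z_j$, $i=\sqrt{-1}$. The complex input $X_j$ satisfies $\mathbb{E}[|X_j|^2]\le P$; the interference $S_{R1},\dots,S_{RN}$ is iid real Gaussian $\mathcal N(0,Q)$; the noise $Z_1,\dots,Z_N$ is iid circularly symmetric complex Gaussian $\mathcal{CN}(0,1)$ (zero mean, unit variance); the phases $\theta_1,\dots,\theta_N$ are iid with the given distribution; interference, noise, phases and message are mutually independent. The transmitter knows the whole sequence $S_R^N$ non-causally (before transmission) but not $\theta^N$; the receiver knows $\theta^N$ but not $S_R^N$. An encoder maps (message $W$ uniform on $\{1,\dots,2^{NR}\}$, $S_R^N$) to $X^N$, and a decoder maps $(Y^N,\theta^N)$ to an estimate of $W$. A rate $R$ is achievable if there are codes of rate $R$ with error probability tending to $0$ as $N\to\infty$; the capacity $C$ is the supremum of achievable rates. All logarithms are base 2. *)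

(* Defs.v *)
From HB Require Import structures.
From mathcomp Require Import all_boot all_order all_algebra.
From mathcomp Require Import complex.
From mathcomp Require Import all_classical all_reals all_analysis.

Set Implicit Arguments.
Unset Strict Implicit.
Unset Printing Implicit Defensive.

Import Order.TTheory GRing.Theory Num.Theory.
Import numFieldNormedType.Exports.

Local Open Scope classical_set_scope.
Local Open Scope ring_scope.
Local Open Scope complex_scope.

Section complex_measurable.
Context {R : realType}.

Definition reim (z : R[i]) : R * R := let: x +i* y := z in (x, y).

Definition complex_of (p : R * R) : R[i] := p.1 +i* p.2.

(* [R[i]] gets the Borel sigma-algebra of the plane, pulled back along
   [reim]. *)
Definition measurable_complex : set (set R[i]) :=
  preimage_set_system [set: R[i]] reim measurable.

Let sigma_algebra_complex : sigma_algebra setT measurable_complex :=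
  @sigma_algebra_preimage _ _ _ setT reim (sigma_algebra_measurable (R * R)%type).

Let measurable_complexC A :
  measurable_complex A -> measurable_complex (~` A).
Proof. by case: sigma_algebra_complex => _ + _ => /[apply]; rewrite setTD. Qed.

Let measurable_complex0 : measurable_complex set0.
Proof. by case: sigma_algebra_complex. Qed.

Let measurable_complex_bigcup (F : (set R[i])^nat) :
  (forall k, measurable_complex (F k)) -> measurable_complex (\bigcup_k F k).
Proof. by case: sigma_algebra_complex => _ _; exact. Qed.

HB.instance Definition _ := isPointed.Build R[i] 0.
HB.instance Definition _ := @isMeasurable.Build default_measure_display R[i]
  measurable_complex measurable_complex0 measurable_complexC
  measurable_complex_bigcup.

Lemma measurable_complex_of : measurable_fun [set: R * R] complex_of.
Proof.
move=> _ _ [B mB <-]; rewrite setTI.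
rewrite [X in measurable X](_ : _ = B)//.
by apply/seteqP; split=> -[a b] //= [].
Qed.

HB.instance Definition _ :=
  isMeasurableFun.Build _ _ _ _ complex_of measurable_complex_of.

Definition expi (t : R) : R[i] := cos t +i* sin t.

Definition abs2 (z : R[i]) : R := ComplexField.Normc.normc z ^+ 2.

End complex_measurable.

Section iid.
Context d (T : measurableType d) (R : realType).

Definition tcons n (p : T * n.-tuple T) : n.+1.-tuple T := [tuple of p.1 :: p.2].

Lemma measurable_tcons n : measurable_fun setT (@tcons n).
Proof. exact: measurable_cons. Qed.

HB.instance Definition _ n :=
  isMeasurableFun.Build _ _ _ _ (@tcons n) (@measurable_tcons n).

(* The law of n independent draws from [mu]. *)
Fixpoint iid (mu : probability T R) n : probability (n.-tuple T) R :=
  if n is m.+1 then distribution (mu \x iid mu m)%E (@tcons m)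
  else \d_[tuple].

End iid.

Section phase_fading_dirty_paper.
Context {R : realType}.

(* The library's laws live on [measurableTypeR R], whose display differs from
   that of the canonical structure on [R]; [id_real] only changes the
   display. *)
Definition id_real : measurableTypeR R -> R := idfun.

Lemma measurable_id_real : measurable_fun setT id_real.
Proof. exact: (@measurable_id _ _ setT). Qed.

HB.instance Definition _ :=
  @isMeasurableFun.Build _ _ _ _ id_real measurable_id_real.

Definition log2 (x : R) : R := ln x / ln 2.

(* N(0, v); [normal_prob] is parameterized by the standard deviation. *)
Definition normal0 (v : R) : probability R R :=
  distribution (normal_prob 0 (Num.sqrt v)) id_real.

(* CN(0, 1): the real and imaginary parts are independent N(0, 1/2). *)
Definition cnormal : probability R[i] R :=
  distribution (normal0 2^-1 \x normal0 2^-1)%E complex_of.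

Record code (M N : nat) := Code {
  encode : 'I_M -> N.-tuple R -> N.-tuple R[i];
  decode : N.-tuple R[i] * N.-tuple R -> 'I_M;
  measurable_encode : forall w, measurable_fun setT (encode w);
  measurable_decode : forall w, measurable (decode @^-1` [set w])
}.

Definition output N (x : N.-tuple R[i]) (s theta : N.-tuple R)
    (z : N.-tuple R[i]) : N.-tuple R[i] :=
  [tuple tnth x j + expi (tnth theta j) * (tnth s j)%:C + tnth z j | j < N].

(* The joint law of (S_R^N, theta^N, Z^N). *)
Definition channel_law (Q : R) (phase : probability R R) N :
    probability (N.-tuple R * N.-tuple R * N.-tuple R[i])%type R :=
  (iid (normal0 Q) N \x iid phase N \x iid cnormal N)%E.

(* Expectation over a message W uniform on 'I_M and independent of the channel,
   [f w] being the conditional expectation given W = w. *)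
Definition message_mean M (f : 'I_M -> \bar R) : \bar R :=
  ((M%:R^-1)%:E * \sum_(w < M) f w)%E.

Definition error_event M N (c : code M N) (w : 'I_M) :
    set (N.-tuple R * N.-tuple R * N.-tuple R[i]) :=
  [set o | let: (s, theta, z) := o in
           decode c (output (encode c w s) s theta z, theta) <> w].

Definition error_probability (Q : R) (phase : probability R R) M N
    (c : code M N) : \bar R :=
  message_mean (fun w => channel_law Q phase N (error_event c w)).

Definition power_constrained (P Q : R) M N (c : code M N) : Prop :=
  forall j : 'I_N,
    (message_mean (fun w =>
       \int[iid (normal0 Q) N]_s (abs2 (tnth (encode c w s) j))%:E)
     <= P%:E)%E.

(* 2^(N r) messages, rounded up to an integer. *)
Definition nb_messages (r : R) (N : nat) : nat :=
  `|Num.ceil (2 `^ (N%:R * r))|%N.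

Definition achievable (P Q : R) (phase : probability R R) (r : R) : Prop :=
  0 <= r /\
  exists c : forall N, code (nb_messages r N) N,
    (forall N, power_constrained P Q (c N)) /\
    (fun N => error_probability Q phase (c N)) @ \oo --> 0%E.

(* In bits per channel use. *)
Definition capacity (P Q : R) (phase : probability R R) : \bar R :=
  ereal_sup [set r%:E | r in achievable P Q phase].

Lemma two_pi_gt0 : 0 < 2 * pi :> R.
Proof. by rewrite mulr_gt0// pi_gt0. Qed.

(* [uniform_prob] is defined from the density on the closed interval
   [0, 2 pi]; the endpoint is Lebesgue-null, so this is also the uniform law
   on [0, 2 pi[. *)
Definition uniform_phase : probability R R :=
  distribution (uniform_prob two_pi_gt0) id_real.

End phase_fading_dirty_paper.

(* Main.v *)
Require Import Defs.
From mathcomp Require Import all_boot all_order all_algebra.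
From mathcomp Require Import complex.
From mathcomp Require Import all_classical all_reals all_analysis.
From mathcomp Require Import measurable_realfun charge ring lra.

Set Implicit Arguments.
Unset Strict Implicit.
Unset Printing Implicit Defensive.

Import Order.TTheory GRing.Theory Num.Theory.
Import numFieldNormedType.Exports.

Local Open Scope classical_set_scope.
Local Open Scope ring_scope.

(* After derotation by the known phase, the real interference only reaches one
   of the two real coordinates of the channel output, so treating interference
   as noise already loses at most a constant: the encoder ignores S. Codewords
   are taken in a fine square grid of constant peak power and decoded by maximum
   likelihood for independent Gaussian coordinates of variances Q + 1/2 and 1/2.
   The union bound with Chernoff parameter 1/2 reduces the error probability to
   (M - 1) B^N, where B bounds the average of exp(-q) over the grid, q being a
   rotated quadratic form. Comparing this average with a Gaussian integral,
   uniformly in the rotation, gives rate -log B, which is within 3 bits of the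
   target. *)

(** * Gaussian integrals *)

Section normal_integral.
Context {R : realType}.
Local Notation mu := (@lebesgue_measure R).

(** The Radon-Nikodym derivative of the law and [normal_pdf] have the same integral on every
    measurable set, hence agree almost everywhere. *)
Lemma ge0_integral_normal_prob (m s : R) (f : R -> \bar R) :
  measurable_fun setT f -> (forall x, 0 <= f x)%E ->
  (\int[normal_prob m s]_x f x = \int[mu]_x (f x * (normal_pdf m s x)%:E))%E.
Proof.
move=> mf f0.
have dom : normal_prob m s `<< mu by exact: normal_prob_dominates.
rewrite -(Radon_Nikodym_SigmaFinite.change_of_variables dom)//.
apply: ae_eq_integral => //.
- apply: emeasurable_funM => //; apply: (measurable_int mu).
  exact: Radon_Nikodym_SigmaFinite.f_integrable.
- apply: emeasurable_funM => //; apply/measurable_EFinP.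
  exact: measurable_normal_pdf.
- apply: ae_eqe_mul2l; apply: integral_ae_eq => //.
  + exact: Radon_Nikodym_SigmaFinite.f_integrable.
  + by apply/measurable_EFinP; exact: measurable_normal_pdf.
  + by move=> E _ mE; rewrite -Radon_Nikodym_SigmaFinite.f_integral.
Qed.

Lemma integral_normal_prob_expR (s t : R) : s != 0 ->
  (\int[normal_prob 0 s]_x (expR (t * x))%:E =
   (expR (s ^+ 2 * t ^+ 2 / 2))%:E)%E.
Proof.
move=> s0; rewrite ge0_integral_normal_prob//; last first.
  apply/measurable_EFinP/measurableT_comp => //; exact: measurable_funM.
(* Completing the square: the tilt by [expR (t * x)] moves the mean to [s ^+ 2 * t] and leaves a
   constant factor. *)
transitivity (\int[mu]_x ((expR (s ^+ 2 * t ^+ 2 / 2))%:E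
    * (normal_pdf (s ^+ 2 * t) s x)%:E))%E; last first.
  rewrite ge0_integralZl//.
  - by rewrite integral_normal_pdf mule1.
  - by apply/measurable_EFinP; exact: measurable_normal_pdf.
  - by move=> x _; rewrite lee_fin normal_pdf_ge0.
apply: eq_integral => x _; rewrite -!EFinM !normal_pdfE// /normal_fun.
congr EFin; rewrite mulrCA [RHS]mulrCA -!expRD; congr (_ * expR _).
by field.
Qed.

Lemma integral_normal0_expR (v t : R) : 0 < v ->
  (\int[normal0 v]_x (expR (t * x))%:E = (expR (v * t ^+ 2 / 2))%:E)%E.
Proof.
move=> v0; rewrite ge0_integral_distribution//=; last first.
  by apply/measurable_EFinP/measurableT_comp => //; exact: measurable_funM.
rewrite integral_normal_prob_expR ?sqr_sqrtr ?(ltW v0)//.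
by rewrite gt_eqF// sqrtr_gt0.
Qed.

End normal_integral.

Section iid_integral.
Context d (T : measurableType d) (R : realType) (mu : probability T R).

Lemma measurable_prod_tnth n (f : 'I_n -> T -> R) :
  (forall j, measurable_fun setT (f j)) ->
  measurable_fun setT (fun x : n.-tuple T => \prod_(j < n) f j (tnth x j)).
Proof.
move=> mf; apply: measurable_prod => j _.
by apply: measurableT_comp => //; exact: measurable_tnth.
Qed.

(** Independence in the form used below: Tonelli splits off the first coordinate, and the inner
    integral is the induction hypothesis. *)
Lemma integral_iid_prod n (f : 'I_n -> T -> R) (g : 'I_n -> R) :
  (forall j, measurable_fun setT (f j)) -> (forall j x, 0 <= f j x) ->
  (forall j, \int[mu]_x (f j x)%:E = (g j)%:E)%E ->
  (\int[iid mu n]_x (\prod_(j < n) f j (tnth x j))%:E =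
   (\prod_(j < n) g j)%:E)%E.
Proof.
elim: n f g => [|n ih] f g mf f0 fg.
  rewrite big_ord0; under eq_integral do rewrite big_ord0.
  by rewrite integral_cst//= probability_setT mule1.
have mprod := measurable_prod_tnth mf.
rewrite ge0_integral_distribution//=; first last.
- by move=> y; rewrite lee_fin prodr_ge0.
- exact/measurable_EFinP.
rewrite fubini_tonelli1//=; first last.
- by move=> y; rewrite /= lee_fin prodr_ge0.
- apply/measurable_EFinP.
  exact: (measurableT_comp mprod (@measurable_tcons _ _ n)).
rewrite /fubini_F/= big_ord_recl EFinM.
transitivity (\int[mu]_x ((f ord0 x)%:E *
    (\prod_(i < n) g (lift ord0 i))%:E))%E.
  apply: eq_integral => x _.
  rewrite -(ih (fun j => f (lift ord0 j)))//= -ge0_integralZl//=; last 3 first.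
  - apply/measurable_EFinP.
    exact: (@measurable_prod_tnth _ (fun j => f (lift ord0 j))).
  - by move=> y _; rewrite lee_fin prodr_ge0.
  - by rewrite lee_fin.
  apply: eq_integral => y _; rewrite big_ord_recl tnth0 EFinM.
  by congr (_ * _%:E)%E; apply: eq_bigr => j _; rewrite tnthS.
rewrite ge0_integralZr//=; last first.
- rewrite lee_fin prodr_ge0// => j _.
  by rewrite -lee_fin -fg integral_ge0// => x _; rewrite lee_fin.
- by move=> x _; rewrite lee_fin.
- exact/measurable_EFinP.
by rewrite fg.
Qed.

End iid_integral.

Section complex_noise.
Context {R : realType}.

Lemma measurable_reim : measurable_fun [set: R[i]] (@reim R).
Proof. by move=> _ B mB; rewrite setTI; exists B => //; rewrite setTI. Qed.

Lemma measurable_Re : measurable_fun [set: R[i]] (@complex.Re R).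
Proof.
rewrite (_ : @complex.Re R = fst \o @reim R); last by apply/funext => -[].
exact: (measurableT_comp measurable_fst measurable_reim).
Qed.

Lemma measurable_Im : measurable_fun [set: R[i]] (@complex.Im R).
Proof.
rewrite (_ : @complex.Im R = snd \o @reim R); last by apply/funext => -[].
exact: (measurableT_comp measurable_snd measurable_reim).
Qed.

Lemma measurable_fun_complex d (T : measurableType d) (f : T -> R[i]) :
  measurable_fun setT (fun x => complex.Re (f x)) ->
  measurable_fun setT (fun x => complex.Im (f x)) ->
  measurable_fun setT f.
Proof.
move=> mr mi.
rewrite (_ : f = @complex_of R \o
  (fun x => (complex.Re (f x), complex.Im (f x)))); last first.
  by apply/funext => x /=; case: (f x).
by apply: measurableT_comp => //; exact: measurable_fun_pair.
Qed.

(** Each real coordinate of the noise has variance 1/2, whence the denominator 4. *)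
Lemma integral_cnormal_expR (p q : R) :
  (\int[cnormal]_z (expR (p * complex.Re z + q * complex.Im z))%:E =
   (expR ((p ^+ 2 + q ^+ 2) / 4))%:E)%E.
Proof.
have mE : measurable_fun [set: R[i]]
    (fun z => (expR (p * complex.Re z + q * complex.Im z))%:E).
  apply/measurable_EFinP/measurableT_comp => //.
  apply: measurable_funD; apply: measurable_funM => //.
  - exact: measurable_Re.
  - exact: measurable_Im.
rewrite ge0_integral_distribution//=.
have mexp (t : R) : measurable_fun setT (fun x : R => (expR (t * x))%:E).
  by apply/measurable_EFinP/measurableT_comp => //; exact: measurable_funM.
rewrite fubini_tonelli1//=; last first.
  exact: (measurableT_comp mE (@measurable_complex_of R)).
rewrite /fubini_F/=.
have half0 : 0 < 2^-1 :> R by rewrite invr_gt0.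
under eq_integral => x _.
  under eq_integral do rewrite expRD EFinM.
  rewrite ge0_integralZl//= integral_normal0_expR//.
  over.
rewrite ge0_integralZr//= integral_normal0_expR// -EFinM -expRD.
by congr (expR _)%:E; field.
Qed.

End complex_noise.

(** * Sums of Gaussians over a rotated grid *)

Section unimodal_sum.
Context {R : realType}.
(* [F] stands for the distribution function of the unimodal density [g]. *)
Variables (F g : R -> R) (c h : R).
Hypothesis F_ge0 : forall x, 0 <= F x.
Hypothesis F_le1 : forall x, F x <= 1.
Hypothesis F_lb : forall a b m, a <= b -> 0 <= m ->
  (forall x, a <= x <= b -> m <= g x) -> m * (b - a) <= F b - F a.
Hypothesis g_ge0 : forall x, 0 <= g x.
Hypothesis g_le : forall x, g x <= c.
Hypothesis g_nincr : forall x y, 0 <= x <= y -> g y <= g x.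
Hypothesis g_ndecr : forall x y, x <= y <= 0 -> g x <= g y.
Hypothesis h_gt0 : 0 < h.

Let sum_succ y K : \sum_(k < K) g (h * k.+1%:R + y) =
  \sum_(k < K) g (h * k%:R + (y + h)).
Proof. by apply: eq_bigr => k _; congr g; rewrite -addn1 natrD; ring. Qed.

Let sum_recl y K : \sum_(k < K.+1) g (h * k%:R + y) =
  g y + \sum_(k < K) g (h * k%:R + (y + h)).
Proof. by rewrite big_ord_recl mulr0 add0r -sum_succ. Qed.

(** Right of the mode, each term is at most the mass of the cell ending at its point, and these
    masses telescope. *)
Let sum_pos K y : 0 <= y ->
  h * \sum_(k < K) g (h * k%:R + (y + h)) <= 1 - F y.
Proof.
elim: K y => [|K ih] y y0.
  by rewrite big_ord0 mulr0 subr_ge0.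
rewrite sum_recl mulrDr.
have yh0 : 0 <= y + h by rewrite addr_ge0// ltW.
have yyh : y <= y + h by rewrite lerDl ltW.
have gyh x : y <= x <= y + h -> g (y + h) <= g x.
  by move=> /andP[yx xyh]; rewrite g_nincr// xyh andbT (le_trans y0).
have := ih _ yh0; have := F_lb yyh (g_ge0 _) gyh.
by rewrite [y + h - y]addrC addKr [_ * h]mulrC; lra.
Qed.

(** Left of the mode a term is charged to the cell on its right, right of the mode to the cell on
    its left. The cells are disjoint, so the total mass 1 pays for all terms but the two next to the
    mode, which cost at most [h * c] each. *)
Lemma unimodal_sum_le K y : h * \sum_(k < K) g (h * k%:R + y) <= 2 * (h * c) + 1.
Proof.
have c0 : 0 <= h * c by rewrite mulr_ge0 ?(ltW h_gt0) ?(le_trans (g_ge0 0)).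
have hgc z : h * g z <= h * c by rewrite ler_pM2l.
have pos n z : 0 <= z -> h * \sum_(k < n) g (h * k%:R + z) <= h * c + 1 - F z.
  case: n => [|n] z0; last first.
    by rewrite sum_recl mulrDr; have := sum_pos n z0; have := hgc z; lra.
  by rewrite big_ord0 mulr0; have := F_le1 z; lra.
(* Keeping the mass [F y] left of the starting point in the bound lets the induction on [K]
   telescope. *)
suff: h * \sum_(k < K) g (h * k%:R + y) <= 2 * (h * c) + 1 - F y.
  by have := F_ge0 y; lra.
elim: K y => [|K ih] y.
  by rewrite big_ord0 mulr0; have := F_le1 y; lra.
have [y0|y0] := lerP 0 y; first by have := pos K.+1 y y0; lra.
have yyh : y <= y + h by rewrite lerDl ltW.
rewrite sum_recl mulrDr; have [yh|yh] := lerP (y + h) 0.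
  have gy x : y <= x <= y + h -> g y <= g x.
    by move=> /andP[yx xyh]; rewrite g_ndecr// yx (le_trans xyh).
  have := F_lb yyh (g_ge0 _) gy.
  by rewrite [y + h - y]addrC addKr [_ * h]mulrC; have := ih (y + h); lra.
have := F_lb yyh (lexx 0) (fun x _ => g_ge0 x).
have := pos K (y + h) (ltW yh); have := hgc y; lra.
Qed.

End unimodal_sum.

Section gaussian_sums.
Context {R : realType}.
Implicit Types (a r h y z : R).

(** With [s] such that [1 / (2 s^2) = r^2], the summand is a normal density divided by its peak [p],
    and the unimodal bound applies uniformly in [y] and [K]. *)
Lemma gauss_sum_le r h y K : 0 < r -> 0 < h ->
  \sum_(k < K) expR (- (r * (h * k%:R + y)) ^+ 2) <= 2 + 2 / (h * r).
Proof.
move=> r0 h0; pose s := (Num.sqrt 2 * r)^-1.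
have s2 : s ^+ 2 = (2 * r ^+ 2)^-1 by rewrite exprVn exprMn sqr_sqrtr.
have s0 : s != 0 by rewrite invr_eq0 mulf_neq0 ?gt_eqF ?sqrtr_gt0.
pose mu := @normal_prob R 0 s.
pose F y : R := fine (mu [set` `]-oo, y]]).
pose p := @normal_peak R s.
have p0 : 0 < p by exact: normal_peak_gt0.
have pdfE x : normal_pdf 0 s x = p * expR (- (r * x) ^+ 2).
  rewrite normal_pdfE// /normal_fun s2; congr (_ * expR _).
  by have := gt_eqF r0 => /negbT ?; field.
have F_fin (A : set R) : measurable A -> mu A \is a fin_num.
  by move=> mA; apply: fin_num_measure.
have Fge0 x : 0 <= F x by rewrite fine_ge0.
have Fle1 x : F x <= 1.
  rewrite -lee_fin fineK ?F_fin//; exact: probability_le1.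
have Flb a b m : a <= b -> 0 <= m ->
    (forall x, a <= x <= b -> m <= normal_pdf 0 s x) ->
    m * (b - a) <= F b - F a.
  move=> ab m0 mg.
  have mE : (mu [set` `]-oo, b]] = mu [set` `]-oo, a]] + mu [set` `]a, b]])%E.
    rewrite -measureU//=.
      by rewrite -itv_bndbnd_setU.
    by apply/seteqP; split=> x //=; rewrite !in_itv/=; lra.
  have -> : F b - F a = fine (mu [set` `]a, b]]).
    by rewrite /F mE fineD ?F_fin// addrC addKr.
  rewrite -lee_fin fineK ?F_fin//.
  have -> : (m * (b - a))%:E =
     (\int[lebesgue_measure]_(x in `]a, b]) m%:E)%E.
    rewrite integral_cst//= lebesgue_measure_itv/= lte_fin.
    have [->|ne] := eqVneq a b; first by rewrite ltxx subrr mulr0 mule0.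
    by rewrite lt_neqAle ne ab -EFinD EFinM.
  apply: ge0_le_integral => //.
  - apply/measurable_EFinP/measurable_funTS; exact: measurable_normal_pdf.
  - move=> x /=; rewrite in_itv/= => xab; rewrite lee_fin mg//; lra.
have g0 x : 0 <= normal_pdf 0 s x by exact: normal_pdf_ge0.
have gp x : normal_pdf 0 s x <= p by exact: normal_pdf_ub.
have sq x z : x ^+ 2 <= z ^+ 2 -> normal_pdf 0 s z <= normal_pdf 0 s x.
  move=> xz; rewrite !pdfE ler_pM2l// ler_expR lerN2 !exprMn ler_pM2l//.
  by rewrite exprn_gt0.
have g1 u w : 0 <= u <= w -> normal_pdf 0 s w <= normal_pdf 0 s u.
  by move=> uw; apply: sq; nra.
have g2 u w : u <= w <= 0 -> normal_pdf 0 s u <= normal_pdf 0 s w.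
  by move=> uw; apply: sq; nra.
have := @unimodal_sum_le R F (normal_pdf 0 s) p h Fge0 Fle1 Flb g0 gp g1 g2 h0 K y.
under eq_bigr do rewrite pdfE.
rewrite -mulr_sumr; set S := \sum_(k < K) _ => main.
have r_neq0 : r != 0 by rewrite gt_eqF.
have h_neq0 : h != 0 by rewrite gt_eqF.
(* [p^-1] is the Gaussian integral [sqrt pi / r], and pi < 4. *)
have p_inv : p^-1 <= 2 / r.
  have r20 : 0 <= 2 / r by rewrite divr_ge0// ltW.
  rewrite /p /normal_peak invrK -[leRHS]ger0_norm// -sqrtr_sqr.
  rewrite ler_sqrt ?sqr_ge0// s2.
  have := @pihalf_lt2 R.
  have -> : (2 * r ^+ 2)^-1 * pi *+ 2 = (2 / r) ^+ 2 * (pi / 4) by field.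
  by move=> pi4; rewrite ler_piMr ?sqr_ge0//; lra.
have p1 : 1 <= h * p * (2 / (h * r)).
  have hr u : h * u * (2 / (h * r)) = u * (2 / r).
    by field; rewrite r_neq0 h_neq0.
  rewrite hr.
  by rewrite -ler_pdivrMl// mulr1.
rewrite -(@ler_pM2l _ (h * p)) ?mulr_gt0//.
by rewrite mulrDr; lra.
Qed.

End gaussian_sums.

Section grid_sums.
Context {R : realType}.
Implicit Types (L r h y c d A C : R).

Definition grid L K (k : 'I_K) : R := 2 * L / K%:R * k%:R - L.

Lemma grid_bounds L K (k : 'I_K) : 0 < L -> - L <= grid L k <= L.
Proof.
move=> L0; have K0 : 0 < K%:R :> R by rewrite ltr0n (leq_ltn_trans _ (ltn_ord k)).
rewrite /grid mulrAC -mulrA; have : 0 <= L * (k%:R / K%:R) <= L; last by lra.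
rewrite mulr_ge0 ?divr_ge0 ?(ltW L0)//= ger_pMr// ler_pdivrMr// mul1r.
by rewrite ler_nat ltnW.
Qed.

(* The factor 21/20 absorbs the two extra summands of [gauss_sum_le]; this is
   why [K] has to be large. *)
Lemma grid_sum_le L r y K : 0 < L -> 0 < r <= 2^-1 -> 20 * L <= K%:R ->
  \sum_(k < K) expR (- (r * (grid L k + y)) ^+ 2) <= K%:R * (21/20 / (L * r)).
Proof.
move=> L0 /andP[r0 rh] KL; have K0 : 0 < K%:R :> R by lra.
have h0 : 0 < 2 * L / K%:R by rewrite divr_gt0// mulr_gt0.
have := gauss_sum_le (y - L) K r0 h0.
under [X in X <= _ -> _]eq_bigr do rewrite addrA addrAC -/(grid L _).
move/le_trans; apply.
have -> : 2 + 2 / (2 * L / K%:R * r) = (2 * (L * r) + K%:R) / (L * r).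
  by field; rewrite !gt_eqF.
rewrite [leRHS]mulrA ler_pM2r ?invr_gt0 ?mulr_gt0//.
have : L * r <= L * 2^-1 by rewrite ler_pM2l.
lra.
Qed.

Variables (L c d A C : R) (K : nat).
Hypotheses (L_gt0 : 0 < L) (cd1 : c ^+ 2 + d ^+ 2 = 1) (A_gt0 : 0 < A).
Hypotheses (AC : A <= C) (C_le : C <= 4^-1) (KL : 20 * L <= K%:R).

(** Quadratic form with eigenvalues [A] and [C] along the orthonormal axes [(c, d)] and [(-d, c)];
    its determinant is [A * C] for every rotation. *)
Definition rotated_form (s t : R) : R :=
  A * (c * s + d * t) ^+ 2 + C * (c * t - d * s) ^+ 2.

Let C_gt0 : 0 < C. Proof. exact: lt_le_trans AC. Qed.

Let sqrt_le_half (x : R) : x <= 4^-1 -> Num.sqrt x <= 2^-1.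
Proof.
move=> x4; rewrite -[leRHS]ger0_norm ?invr_ge0// -sqrtr_sqr ler_sqrt ?sqr_ge0//.
by rewrite exprVn; lra.
Qed.

(** Completing the square in the first coordinate splits the double sum into two one-dimensional
    ones. The inner shift depends on the outer point, which is harmless because [grid_sum_le] is
    uniform in the shift. *)
Lemma rotated_grid_sum_le2 y1 y2 :
  \sum_(p : 'I_K * 'I_K)
    expR (- rotated_form (grid L p.1 + y1) (grid L p.2 + y2))
  <= K%:R ^+ 2 * ((21/20) ^+ 2 / (L ^+ 2 * Num.sqrt (A * C))).
Proof.
have [cd A0 leAC leC] := And4 cd1 A_gt0 AC C_le.
(* [al] is the coefficient of [s ^+ 2], a convex combination of [A] and [C]; [ga] is the determinant
   divided by [al]. Both are at most [C], as [grid_sum_le] requires. *)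
pose al := A * c ^+ 2 + C * d ^+ 2.
have al1 : A <= al <= C.
  have : c ^+ 2 = 1 - d ^+ 2 by lra.
  by rewrite /al => ->; have := sqr_ge0 c; have := sqr_ge0 d; nra.
have al0 : 0 < al by lra.
pose ga := A * C / al.
have ga0 : 0 < ga by rewrite /ga !(mulr_gt0, invr_gt0).
have ga1 : ga <= C by rewrite /ga ler_pdivrMr// mulrC ler_pM2l//; lra.
pose b := (A - C) * c * d / al.
have formE s t : rotated_form s t =
    (Num.sqrt al * (s + b * t)) ^+ 2 + (Num.sqrt ga * t) ^+ 2.
  rewrite !exprMn !sqr_sqrtr ?ltW//.
  (* This disguised 1, the square of [c ^+ 2 + d ^+ 2], makes the numerator of the [t ^+ 2]
     coefficient divisible by [al]. *)
  have : c ^+ 4 + d ^+ 4 + 2 * c ^+ 2 * d ^+ 2 = 1.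
    by transitivity ((c ^+ 2 + d ^+ 2) ^+ 2); [ring|rewrite cd1 expr1n].
  have al_neq0 : al != 0 by rewrite gt_eqF.
  move=> cd4; rewrite /rotated_form.
  have -> : al * (s + b * t) ^+ 2 + ga * t ^+ 2 = al * s ^+ 2 +
      2 * ((A - C) * c * d) * s * t + ((A - C) ^+ 2 * c ^+ 2 * d ^+ 2 +
      A * C * (c ^+ 4 + d ^+ 4 + 2 * c ^+ 2 * d ^+ 2)) / al * t ^+ 2.
    by rewrite cd4 /b /ga; field.
  have -> : (A - C) ^+ 2 * c ^+ 2 * d ^+ 2 +
      A * C * (c ^+ 4 + d ^+ 4 + 2 * c ^+ 2 * d ^+ 2) =
      (A * d ^+ 2 + C * c ^+ 2) * al by rewrite /al; ring.
  by rewrite mulfK// /al; ring.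
rewrite -(pair_bigA _ (fun i j => expR (- rotated_form (grid L i + y1)
  (grid L j + y2))))/= exchange_big/=.
have inner (j : 'I_K) : \sum_(i < K)
    expR (- rotated_form (grid L i + y1) (grid L j + y2)) <=
    K%:R * (21/20 / (L * Num.sqrt al)) *
    expR (- (Num.sqrt ga * (grid L j + y2)) ^+ 2).
  under eq_bigr do rewrite formE opprD expRD -addrA.
  rewrite -mulr_suml ler_wpM2r ?expR_ge0//.
  apply: grid_sum_le => //; rewrite sqrtr_gt0 al0/= sqrt_le_half//; lra.
apply: le_trans; first by apply: ler_sum => j _; exact: inner.
rewrite -mulr_sumr.
have outer : \sum_(j < K) expR (- (Num.sqrt ga * (grid L j + y2)) ^+ 2) <=
    K%:R * (21/20 / (L * Num.sqrt ga)).
  apply: grid_sum_le => //; rewrite sqrtr_gt0 ga0/= sqrt_le_half//; lra.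
have pos : 0 <= K%:R * (21/20 / (L * Num.sqrt al)).
  by rewrite mulr_ge0// divr_ge0// mulr_ge0 ?sqrtr_ge0 ?ltW.
apply: (le_trans (ler_wpM2l pos outer)).
have -> : A * C = al * ga by rewrite /ga [RHS]mulrC divfK// gt_eqF.
rewrite (sqrtrM ga (ltW al0)) le_eqVlt; apply/orP; left; apply/eqP.
have : Num.sqrt al != 0 by rewrite gt_eqF ?sqrtr_gt0.
have : Num.sqrt ga != 0 by rewrite gt_eqF ?sqrtr_gt0.
move: (Num.sqrt al) (Num.sqrt ga) => u v v0 u0.
by field; rewrite u0 v0 gt_eqF.
Qed.

(** Only the square with the larger eigenvalue [C] is kept. Summation runs along a coordinate axis
    on which it has at least half its weight, and the other coordinate contributes a plain factor
    [K]. *)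
Lemma rotated_grid_sum_le1 y1 y2 :
  \sum_(p : 'I_K * 'I_K)
    expR (- rotated_form (grid L p.1 + y1) (grid L p.2 + y2))
  <= K%:R ^+ 2 * (21/20 * (Num.sqrt 2 / (L * Num.sqrt C))).
Proof.
have [cd A0 leAC leC] := And4 cd1 A_gt0 AC C_le.
set B := 21/20 * _.
(* [e] will be whichever of [c], [d] has square at least 1/2; the factor [Num.sqrt 2] in [B] pays
   for that half. *)
have line e w : 2^-1 <= e ^+ 2 <= 1 ->
    \sum_(k < K) expR (- (C * (e * (grid L k + w)) ^+ 2)) <= K%:R * B.
  move=> /andP[e1 e2]; pose r := Num.sqrt (C * e ^+ 2).
  have Ce0 : 0 < C * e ^+ 2 by rewrite mulr_gt0//; lra.
  have Ce4 : C * e ^+ 2 <= 4^-1.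
    by rewrite (le_trans _ C_le)// ger_pMr.
  have r0 : 0 < r by rewrite sqrtr_gt0.
  have sC0 : 0 < Num.sqrt C by rewrite sqrtr_gt0.
  have rC : Num.sqrt C <= Num.sqrt 2 * r.
    rewrite -sqrtrM// ler_sqrt; first by nra.
    by rewrite mulr_ge0// ltW.
  have rE z : C * (e * z) ^+ 2 = (r * z) ^+ 2.
    by rewrite !exprMn sqr_sqrtr ?(ltW Ce0)// mulrA.
  under eq_bigr do rewrite rE.
  apply: le_trans (grid_sum_le _ L_gt0 _ KL) _.
    by rewrite r0/= sqrt_le_half.
  rewrite ler_pM2l ?ltr0n; last first.
    by rewrite -(ltr_nat R); move: KL L_gt0; lra.
  rewrite /B ler_pM2l ?divr_gt0// ler_pdivlMr ?mulr_gt0//.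
  have -> : (L * r)^-1 * (L * Num.sqrt C) = Num.sqrt C / r.
    by move: (Num.sqrt C) (r) r0 L_gt0 => u v v0 L0; field; rewrite !gt_eqF.
  by rewrite ler_pdivrMr.
have [c2|c2] := lerP 2^-1 (c ^+ 2).
  rewrite -(pair_bigA _ (fun i j => expR (- rotated_form (grid L i + y1)
    (grid L j + y2))))/=.
  have inner (i : 'I_K) : \sum_(j < K)
    expR (- rotated_form (grid L i + y1) (grid L j + y2)) <= K%:R * B.
    have c0 : c != 0 by apply/eqP => c0; move: c2; rewrite c0 expr0n/=; lra.
    apply: le_trans (line c (y2 - d / c * (grid L i + y1)) _); last first.
      by rewrite c2/=; have := sqr_ge0 d; lra.
    apply: ler_sum => j _; rewrite ler_expR lerN2 /rotated_form.
    have -> : c * (grid L j + (y2 - d / c * (grid L i + y1))) =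
      c * (grid L j + y2) - d * (grid L i + y1) by field.
    by rewrite lerDr mulr_ge0 ?sqr_ge0 ?(ltW A_gt0).
  apply: le_trans; first by apply: ler_sum => i _; exact: inner.
  by rewrite sumr_const card_ord -[leLHS]mulr_natl expr2 -[leRHS]mulrA.
rewrite -(pair_bigA _ (fun i j => expR (- rotated_form (grid L i + y1)
    (grid L j + y2))))/= exchange_big/=.
have inner (j : 'I_K) : \sum_(i < K)
    expR (- rotated_form (grid L i + y1) (grid L j + y2)) <= K%:R * B.
  have d2 : 2^-1 <= d ^+ 2 by lra.
  have d0 : d != 0 by apply/eqP => d0; move: d2; rewrite d0 expr0n/=; lra.
  apply: le_trans (line d (y1 - c / d * (grid L j + y2)) _); last first.
    by rewrite d2/=; have := sqr_ge0 c; lra.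
  apply: ler_sum => i _; rewrite ler_expR lerN2 /rotated_form.
  have -> : d * (grid L i + (y1 - c / d * (grid L j + y2))) =
    - (c * (grid L j + y2) - d * (grid L i + y1)) by field.
  by rewrite sqrrN lerDr mulr_ge0 ?sqr_ge0 ?(ltW A_gt0).
apply: le_trans; first by apply: ler_sum => j _; exact: inner.
by rewrite sumr_const card_ord -[leLHS]mulr_natl expr2 -[leRHS]mulrA.
Qed.

End grid_sums.

(** * Pairwise error bound *)

Section chernoff_bound.
Context {R : realType}.
Variable Q : R.
Hypothesis Q_gt0 : 0 < Q.
Implicit Types (s t : R) (z : R[i]).
Local Open Scope complex_scope.

(* Minus twice the log-likelihood, up to a constant, of the residual [r] of a
   channel use with phase [t] when the interference is treated as noise:
   derotation leaves independent coordinates of variances Q + 1/2 and 1/2. *)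
Definition letter_metric (r : R[i]) t : R :=
  (cos t * complex.Re r + sin t * complex.Im r) ^+ 2 / (2 * Q + 1) +
  (cos t * complex.Im r - sin t * complex.Re r) ^+ 2.

(* [delta] is the sent symbol minus a competing one. This is the square root of
   the likelihood ratio of the competing symbol to the sent one; its product
   over a block is at least 1 when the competing codeword wins. *)
Definition likelihood_ratio (delta : R[i]) s t z : R :=
  expR ((letter_metric (expi t * s%:C + z) t -
         letter_metric (delta + (expi t * s%:C + z)) t) / 2).

Definition derot_re (delta : R[i]) t : R :=
  cos t * complex.Re delta + sin t * complex.Im delta.

Definition derot_im (delta : R[i]) t : R :=
  cos t * complex.Im delta - sin t * complex.Re delta.

(** The exponent of the likelihood ratio is affine: [p] and [q] are its slopes along the two
    derotated axes, [k] its constant term. *)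
Let p delta t := - (derot_re delta t / (2 * Q + 1)).
Let q delta t := - derot_im delta t.
Let k delta t := - (derot_re delta t ^+ 2 / (2 * Q + 1) + derot_im delta t ^+ 2) / 2.

(** The squares of the residual cancel in the difference of metrics, and derotation leaves the
    interference on the first axis alone. *)
Lemma likelihood_ratioE delta s t z : likelihood_ratio delta s t z =
  expR (k delta t + p delta t * s +
    ((p delta t * cos t - q delta t * sin t) * complex.Re z +
     (p delta t * sin t + q delta t * cos t) * complex.Im z)).
Proof.
rewrite /likelihood_ratio /letter_metric /k /p /q /derot_re /derot_im; congr expR.
case: delta z => [dr di] [zr zi] /=.
have := cos2Dsin2 t; move: (cos t) (sin t) => c d cd.
have u : c * (c * s - d * 0 + zr) + d * (c * 0 + d * s + zi) =
    s + (c * zr + d * zi).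
  by rewrite -[s in RHS]mul1r -cd; ring.
have v : c * (c * 0 + d * s + zi) - d * (c * s - d * 0 + zr) =
    c * zi - d * zr by ring.
have u' : c * (dr + (c * s - d * 0 + zr)) + d * (di + (c * 0 + d * s + zi)) =
    c * dr + d * di + (s + (c * zr + d * zi)) by rewrite -u; ring.
have v' : c * (di + (c * 0 + d * s + zi)) - d * (dr + (c * s - d * 0 + zr)) =
    c * di - d * dr + (c * zi - d * zr) by ring.
rewrite u v u' v'.
have Q1 : 2 * Q + 1 != 0 by rewrite gt_eqF//; move: Q_gt0; lra.
by field.
Qed.

(** The Bhattacharyya distance of two Gaussians displaced by [delta], with variances [Q + 1/2] and
    1/2 on the derotated axes: squared displacement over eight times the variance. *)
Definition letter_form delta t : R :=
  rotated_form (cos t) (sin t) (4 * (2 * Q + 1))^-1 4^-1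
    (complex.Re delta) (complex.Im delta).

(** The Gaussian averages over interference and noise cancel exactly half of [k]. *)
Let exponentE delta t :
  k delta t + (Q * p delta t ^+ 2 / 2 +
    ((p delta t * cos t - q delta t * sin t) ^+ 2 +
     (p delta t * sin t + q delta t * cos t) ^+ 2) / 4) =
  - letter_form delta t.
Proof.
have -> : (p delta t * cos t - q delta t * sin t) ^+ 2 +
     (p delta t * sin t + q delta t * cos t) ^+ 2 =
    (p delta t ^+ 2 + q delta t ^+ 2) * (cos t ^+ 2 + sin t ^+ 2) by ring.
rewrite cos2Dsin2 mulr1 /letter_form /rotated_form.
rewrite -/(derot_re delta t) -/(derot_im delta t) /k /p /q.
have Q1 : 2 * Q + 1 != 0 by rewrite gt_eqF//; move: Q_gt0; lra.
by field.
Qed.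

Let measurable_cos : measurable_fun setT (@cos R).
Proof. by apply: continuous_measurable_fun; exact: continuous_cos. Qed.

Let measurable_sin : measurable_fun setT (@sin R).
Proof. by apply: continuous_measurable_fun; exact: continuous_sin. Qed.

Let measurable_p delta : measurable_fun setT (p delta).
Proof.
apply: measurableT_comp => //; apply: measurable_funM => //.
by apply: measurable_funD; apply: measurable_funM.
Qed.

Let measurable_q delta : measurable_fun setT (q delta).
Proof.
apply: measurableT_comp => //.
by apply: measurable_funB; apply: measurable_funM.
Qed.

Let measurable_k delta : measurable_fun setT (k delta).
Proof.
apply: measurable_funM => //; apply: measurableT_comp => //.
apply: measurable_funD; [apply: measurable_funM => //|]; apply: measurable_funX.
- by apply: measurable_funD; apply: measurable_funM.
- by apply: measurable_funB; apply: measurable_funM.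
Qed.

Lemma measurable_letter_form delta : measurable_fun setT (letter_form delta).
Proof.
apply: measurable_funD; apply: measurable_funM => //; apply: measurable_funX.
- by apply: measurable_funD; apply: measurable_funM.
- by apply: measurable_funB; apply: measurable_funM.
Qed.

Lemma measurable_likelihood_ratio delta d (T : measurableType d) (f g : T -> R)
    (h : T -> R[i]) :
  measurable_fun setT f -> measurable_fun setT g -> measurable_fun setT h ->
  measurable_fun setT (fun x => likelihood_ratio delta (f x) (g x) (h x)).
Proof.
move=> mf mg mh; under eq_fun do rewrite likelihood_ratioE.
have mp : measurable_fun setT (fun x => p delta (g x)) by exact: measurableT_comp.
have mq : measurable_fun setT (fun x => q delta (g x)) by exact: measurableT_comp.
have mk : measurable_fun setT (fun x => k delta (g x)) by exact: measurableT_comp.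
have mc : measurable_fun setT (fun x => cos (g x)) by exact: measurableT_comp.
have ms : measurable_fun setT (fun x => sin (g x)) by exact: measurableT_comp.
have mr := measurableT_comp (@measurable_Re R) mh.
have mi := measurableT_comp (@measurable_Im R) mh.
apply: measurableT_comp => //; apply: measurable_funD.
  by apply: measurable_funD => //; exact: measurable_funM.
apply: measurable_funD; apply: measurable_funM => //.
- by apply: measurable_funB; apply: measurable_funM.
- by apply: measurable_funD; apply: measurable_funM.
Qed.

Variable phase : probability R R.

Definition letter_bound delta : R :=
  fine (\int[phase]_t (expR (- letter_form delta t))%:E)%E.

Let letter_form_ge0 delta t : 0 <= letter_form delta t.
Proof.
have Q1 : 0 <= 2 * Q + 1 by move: Q_gt0; lra.
by rewrite addr_ge0// mulr_ge0 ?sqr_ge0// invr_ge0 ?mulr_ge0.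
Qed.

(** The integrand is at most 1, so [fine] never meets an infinite value. *)
Lemma letter_boundE delta :
  (\int[phase]_t (expR (- letter_form delta t))%:E = (letter_bound delta)%:E)%E.
Proof.
rewrite /letter_bound fineK// ge0_fin_numE; last first.
  by apply: integral_ge0 => t _; rewrite lee_fin expR_ge0.
apply: (@le_lt_trans _ _ (\int[phase]_t (cst 1%E t))%E); last first.
  by rewrite integral_cst//= probability_setT mule1 ltry.
apply: ge0_le_integral => //.
- apply/measurable_EFinP/measurableT_comp => //.
  by apply: measurableT_comp => //; exact: measurable_letter_form.
- by move=> t _; rewrite lee_fin expR_le1 oppr_le0.
Qed.

(** Noise, then interference, then phase are integrated out; at each stage the integrand is a
    product over channel uses. *)
Lemma integral_likelihood_ratio N (delta : 'I_N -> R[i]) :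
  (\int[channel_law Q phase N]_o
     (\prod_(j < N)
        likelihood_ratio (delta j) (tnth o.1.1 j) (tnth o.1.2 j) (tnth o.2 j))%:E
   = (\prod_(j < N) letter_bound (delta j))%:E)%E.
Proof.
have mtn d (T : measurableType d) d' (T' : measurableType d')
    (f : T' -> N.-tuple T) j : measurable_fun setT f ->
    measurable_fun setT (fun x => tnth (f x) j).
  by move=> mf; exact: (measurableT_comp (@measurable_tnth _ _ _ j) mf).
have m1 : measurable_fun setT (fun o : N.-tuple R * N.-tuple R * N.-tuple R[i] =>
    (\prod_(j < N) likelihood_ratio (delta j) (tnth o.1.1 j) (tnth o.1.2 j)
      (tnth o.2 j))%:E).
  apply/measurable_EFinP; apply: measurable_prod => j _.
  apply: measurable_likelihood_ratio.
  - by apply: mtn; exact: (measurableT_comp measurable_fst measurable_fst).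
  - by apply: mtn; exact: (measurableT_comp measurable_snd measurable_fst).
  - exact: mtn.
rewrite fubini_tonelli1//=; last first.
  by move=> o; rewrite lee_fin prodr_ge0// => j _; rewrite expR_ge0.
rewrite /fubini_F/=.
(* [e2] is what the average over the noise adds to the exponent. *)
pose e2 j t := ((p (delta j) t * cos t - q (delta j) t * sin t) ^+ 2 +
     (p (delta j) t * sin t + q (delta j) t * cos t) ^+ 2) / 4.
have me2 j : measurable_fun setT (e2 j).
  by apply: measurable_funM => //; apply: measurable_funD; apply: measurable_funX;
    [apply: measurable_funB|apply: measurable_funD]; apply: measurable_funM.
pose G (o : N.-tuple R * N.-tuple R) : R := \prod_(j < N)
  expR (k (delta j) (tnth o.2 j) + e2 j (tnth o.2 j) +
    p (delta j) (tnth o.2 j) * tnth o.1 j).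
transitivity (\int[iid (normal0 Q) N \x iid phase N]_o (G o)%:E)%E.
  apply: eq_integral => -[s t] _ /=.
  apply: (@integral_iid_prod _ _ _ _ N
    (fun j z => likelihood_ratio (delta j) (tnth s j) (tnth t j) z)).
  - by move=> j; exact: measurable_likelihood_ratio.
  - by move=> j z; rewrite expR_ge0.
  move=> j; under eq_integral do rewrite likelihood_ratioE expRD EFinM.
  rewrite ge0_integralZl//; last first.
    apply/measurable_EFinP/measurableT_comp => //.
    by apply: measurable_funD; apply: measurable_funM => //;
      [exact: measurable_Re|exact: measurable_Im].
  rewrite integral_cnormal_expR -EFinM -expRD; congr (expR _)%:E.
  by rewrite /e2 addrAC.
have mG : measurable_fun setT (fun o => (G o)%:E).
  apply/measurable_EFinP; apply: measurable_prod => j _.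
  have m2 : measurable_fun setT (fun o : N.-tuple R * N.-tuple R => tnth o.2 j).
    exact: mtn.
  have m3 : measurable_fun setT (fun o : N.-tuple R * N.-tuple R => tnth o.1 j).
    exact: mtn.
  apply: measurableT_comp => //; apply: measurable_funD.
    by apply: measurable_funD; [exact: (measurableT_comp (measurable_k _) m2)|
      exact: (measurableT_comp (me2 _) m2)].
  by apply: measurable_funM => //; exact: (measurableT_comp (measurable_p _) m2).
(* Interference comes before phase: with the phase frozen, the exponent is affine in [s]. *)
rewrite fubini_tonelli2//=; last first.
  by move=> o; rewrite lee_fin prodr_ge0// => j _; rewrite expR_ge0.
rewrite /fubini_G/=.
transitivity (\int[iid phase N]_t
    (\prod_(j < N) expR (- letter_form (delta j) (tnth t j)))%:E)%E.
  apply: eq_integral => t _ /=.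
  apply: (@integral_iid_prod _ _ _ _ N (fun j s => expR (k (delta j) (tnth t j) +
    e2 j (tnth t j) + p (delta j) (tnth t j) * s))).
  - by move=> j; apply: measurableT_comp => //; apply: measurable_funD => //;
      exact: measurable_funM.
  - by move=> j s; rewrite expR_ge0.
  move=> j; under eq_integral do rewrite expRD EFinM.
  rewrite ge0_integralZl//; last first.
    by apply/measurable_EFinP/measurableT_comp => //; exact: measurable_funM.
  rewrite integral_normal0_expR// -EFinM -expRD -exponentE; congr (expR _)%:E.
  by rewrite -/(e2 j _) addrAC addrA.
apply: (@integral_iid_prod _ _ _ _ N (fun j t => expR (- letter_form (delta j) t))).
- move=> j; apply: measurableT_comp => //; apply: measurableT_comp => //.
  exact: measurable_letter_form.
- by move=> j t; rewrite expR_ge0.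
- by move=> j; exact: letter_boundE.
Qed.

End chernoff_bound.

(** * Codebook and decoder *)

Section greedy_codebook.
Context {R : realType} (X : finType) (psi : X -> X -> R) (beta : R).
Hypothesis psi_sym : forall x y, psi x y = psi y x.
Hypothesis psi_sum : forall y, \sum_x psi x y <= #|X|%:R * beta.

Let pair_sum (c : nat -> X) M : R :=
  \sum_(w < M) \sum_(v < M) (if v == w :> nat then 0 else psi (c w) (c v)).

(* Greedy choice: the next codeword does at least as well as a random one. *)
Lemma exists_codebook (x0 : X) M : exists c : nat -> X,
  \sum_(w < M) \sum_(v < M | v != w) psi (c w) (c v) <= M%:R * (M%:R - 1) * beta.
Proof.
suff [c cM] : exists c, pair_sum c M <= M%:R * (M%:R - 1) * beta.
  exists c; apply: le_trans cM; rewrite le_eqVlt; apply/orP; left; apply/eqP.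
  by apply: eq_bigr => w _; rewrite big_mkcond/=; apply: eq_bigr => v _;
    rewrite -val_eqE/=; case: eqP.
elim: M => [|M [c cM]]; first by
  exists (fun=> x0); rewrite /pair_sum big_ord0 !mul0r.
(* Averaging: if every [x] exceeded the bound, the sum over all [x] would contradict [psi_sum]. *)
have [x xM] : exists x, \sum_(v < M) psi x (c v) <= M%:R * beta.
  apply: contrapT => /forallNP nex.
  have : \sum_x \sum_(v < M) psi x (c v) <= #|X|%:R * (M%:R * beta).
    rewrite exchange_big/= mulrCA [leRHS]mulr_natl.
    rewrite -[X in _ *+ X]card_ord -sumr_const.
    by apply: ler_sum => v _; exact: psi_sum.
  apply/negP; rewrite -ltNge [ltLHS]mulr_natl -sumr_const.
  apply: ltr_sum => [|x _]; first by apply/hasP; exists x0; rewrite ?mem_index_enum.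
  by rewrite ltNge; apply/negP; exact: nex.
pose c' i := if i == M then x else c i.
have c'E (i : 'I_M) : c' i = c i by rewrite /c' ltn_eqF.
exists c'; rewrite /pair_sum big_ord_recr/= [in X in _ + X]big_ord_recr/= eqxx addr0.
under eq_bigr => w _.
  rewrite big_ord_recr/= gtn_eqF//.
  over.
rewrite big_split/=.
have c'M : c' M = x by rewrite /c' eqxx.
rewrite c'M.
under [X in _ + X + _]eq_bigr do rewrite c'E psi_sym.
under [X in _ + _ + X]eq_bigr do rewrite c'E ltn_eqF//.
have -> : \sum_(i < M) \sum_(v < M)
    (if v == i :> nat then 0 else psi (c' i) (c' v)) = pair_sum c M.
  by apply: eq_bigr => w _; apply: eq_bigr => v _; rewrite !c'E.
(* By symmetry the new row and the new column each cost at most [M%:R * beta]. *)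
have -> : M.+1%:R * (M.+1%:R - 1) * beta =
    M%:R * (M%:R - 1) * beta + M%:R * beta + M%:R * beta.
  by rewrite -addn1 natrD; ring.
by rewrite -!addrA lerD// lerD.
Qed.

End greedy_codebook.

Section maximum_likelihood_code.
Context {R : realType}.
Variables (Q : R) (M N : nat) (X : 'I_M -> N.-tuple R[i]) (w0 : 'I_M).
Hypothesis Q_gt0 : 0 < Q.
Local Open Scope complex_scope.

Definition metric (w : 'I_M) (o : N.-tuple R[i] * N.-tuple R) : R :=
  \sum_(j < N) letter_metric Q (tnth o.1 j - tnth (X w) j) (tnth o.2 j).

Let best w o := [forall v, (v != w) ==> (metric w o < metric v o)].

(** [best] asks for a strict minimum, so it selects at most one message; without a strict minimum,
    as in a tie, the default [w0] is returned. *)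
Definition ml_decode o : 'I_M := odflt w0 [pick w | best w o].

Let best_inj w v o : best w o -> best v o -> w = v.
Proof.
move=> /forallP bw /forallP bv; apply/eqP; apply: contrapT => /negP wv.
have := bw v; have := bv w; rewrite wv eq_sym wv /=.
by move=> vw /(lt_trans vw); rewrite ltxx.
Qed.

Let ml_decodeP w o : best w o -> ml_decode o = w.
Proof.
rewrite /ml_decode; case: pickP => /= [v bv bw|->//].
exact: best_inj bv bw.
Qed.

Lemma measurable_letter_metric d (T : measurableType d) (f : T -> R[i])
    (g : T -> R) :
  measurable_fun setT f -> measurable_fun setT g ->
  measurable_fun setT (fun x => letter_metric Q (f x) (g x)).
Proof.
move=> mf mg.
have mc : measurable_fun setT (fun x => cos (g x)).
  apply: measurableT_comp mg.
  by apply: continuous_measurable_fun; exact: continuous_cos.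
have ms : measurable_fun setT (fun x => sin (g x)).
  apply: measurableT_comp mg.
  by apply: continuous_measurable_fun; exact: continuous_sin.
have mr := measurableT_comp (@measurable_Re R) mf.
have mi := measurableT_comp (@measurable_Im R) mf.
apply: measurable_funD; first apply: measurable_funM => //.
- by apply: measurable_funX; apply: measurable_funD; apply: measurable_funM.
- by apply: measurable_funX; apply: measurable_funB; apply: measurable_funM.
Qed.

Let mtnth d (T : measurableType d) d' (T' : measurableType d')
    (f : T' -> N.-tuple T) j : measurable_fun setT f ->
    measurable_fun setT (fun x => tnth (f x) j).
Proof. by move=> mf; exact: (measurableT_comp (@measurable_tnth _ _ _ j) mf). Qed.

Let measurable_addC d (T : measurableType d) (f g : T -> R[i]) :
  measurable_fun setT f -> measurable_fun setT g ->
  measurable_fun setT (fun x => f x + g x).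
Proof.
move=> mf mg.
have mfr := measurableT_comp (@measurable_Re R) mf.
have mfi := measurableT_comp (@measurable_Im R) mf.
have mgr := measurableT_comp (@measurable_Re R) mg.
have mgi := measurableT_comp (@measurable_Im R) mg.
apply: measurable_fun_complex.
- rewrite (_ : (fun x => _) = (fun x => complex.Re (f x) + complex.Re (g x))).
    exact: measurable_funD.
  by apply/funext => x; case: (f x) (g x) => [? ?] [].
- rewrite (_ : (fun x => _) = (fun x => complex.Im (f x) + complex.Im (g x))).
    exact: measurable_funD.
  by apply/funext => x; case: (f x) (g x) => [? ?] [].
Qed.

Lemma measurable_metric w : measurable_fun setT (metric w).
Proof.
apply: measurable_sum => j; apply: measurable_letter_metric.
- by apply: measurable_addC => //; exact: mtnth.
- exact: mtnth.
Qed.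

Let measurable_best w : measurable [set o | best w o].
Proof.
rewrite (_ : [set o | _] = \bigcap_(v in [set v | v != w])
    ((fun o => metric w o < metric v o) @^-1` [set true])).
  apply: fin_bigcap_measurable; first exact: finite_finset.
  move=> v _; rewrite -[X in measurable X]setTI.
  by apply: measurable_fun_ltr => //; exact: measurable_metric.
apply/seteqP; split=> o /=.
  by move=> /forallP b v /= vw; have := b v; rewrite vw.
by move=> b; apply/forallP => v; apply/implyP => vw; exact: b.
Qed.

Lemma measurable_ml_decode w : measurable (ml_decode @^-1` [set w]).
Proof.
(* The preimage of the default [w0] also contains the outputs without a strict minimum. *)
rewrite (_ : _ @^-1` _ = [set o | best w o] `|`
  (if w == w0 then \bigcap_(v in setT) ~` [set o | best v o] else set0)).
  apply: measurableU => //; case: ifP => // _.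
  apply: fin_bigcap_measurable; first exact: finite_finset.
  by move=> v _; exact: measurableC.
apply/seteqP; split=> o /=.
  rewrite /ml_decode; case: pickP => /= [v bv <-|nb <-]; first by left.
  by right; rewrite eqxx => v _ /=; rewrite nb.
case; first exact: ml_decodeP.
case: eqP => // -> nb; rewrite /ml_decode; case: pickP => //= v bv.
by have := nb v I; rewrite /= bv.
Qed.

Definition ml_code : Defs.code M N :=
  Defs.Code (fun w => @measurable_cst _ _ _ _ setT (X w)) measurable_ml_decode.

Lemma power_ml_code (P : R) : (0 < M)%N ->
  (forall w j, abs2 (tnth (X w) j) <= P) -> power_constrained P Q ml_code.
Proof.
move=> M0 XP j; rewrite /message_mean.
have intE w : (\int[iid (normal0 Q) N]_s
    (abs2 (tnth (encode ml_code w s) j))%:E = (abs2 (tnth (X w) j))%:E)%E.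
  transitivity (\int[iid (normal0 Q) N]_s (cst (abs2 (tnth (X w) j))%:E s))%E => //.
  rewrite integral_cst//.
  by rewrite -[RHS]mule1; congr (_ * _)%E; exact: probability_setT.
under eq_bigr do rewrite intE.
rewrite sumEFin -EFinM lee_fin ler_pdivrMl ?ltr0n//.
rewrite mulr_natl -[X in _ *+ X]card_ord -sumr_const.
by apply: ler_sum => w _.
Qed.

Variable phase : probability R R.

Let out w (o : N.-tuple R * N.-tuple R * N.-tuple R[i]) :=
  (output (X w) o.1.1 o.1.2 o.2, o.1.2).

Let lr w v (o : N.-tuple R * N.-tuple R * N.-tuple R[i]) : R :=
  \prod_(j < N) likelihood_ratio Q (tnth (X w) j - tnth (X v) j)
    (tnth o.1.1 j) (tnth o.1.2 j) (tnth o.2 j).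

Let lrE w v o : lr w v o = expR ((metric w (out w o) - metric v (out w o)) / 2).
Proof.
rewrite /metric -sumrB mulr_suml expR_sum; apply: eq_bigr => j _.
have outE : tnth (out w o).1 j = tnth (X w) j +
    expi (tnth o.1.2 j) * (tnth o.1.1 j)%:C + tnth o.2 j.
  by rewrite /out tnth_mktuple.
have subE (x y u z : R[i]) : x + u + z - y = x - y + (u + z).
  by rewrite -(addrA x) addrAC.
by rewrite /likelihood_ratio outE !subE subrr add0r.
Qed.

Let measurable_lr w v : measurable_fun setT (lr w v).
Proof.
apply: measurable_prod => j _; apply: measurable_likelihood_ratio => //.
- by apply: mtnth; exact: (measurableT_comp measurable_fst measurable_fst).
- by apply: mtnth; exact: (measurableT_comp measurable_snd measurable_fst).
- exact: mtnth.
Qed.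

Let measurable_out w : measurable_fun setT (out w).
Proof.
apply: measurable_fun_pair; last first.
  exact: (measurableT_comp measurable_snd measurable_fst).
apply/measurable_fun_tnthP => j; rewrite /comp/=.
under eq_fun do rewrite tnth_mktuple.
have m2 : measurable_fun setT
    (fun o : N.-tuple R * N.-tuple R * N.-tuple R[i] => tnth o.1.2 j).
  by apply: mtnth; exact: (measurableT_comp measurable_snd measurable_fst).
have m1 : measurable_fun setT
    (fun o : N.-tuple R * N.-tuple R * N.-tuple R[i] => tnth o.1.1 j).
  by apply: mtnth; exact: (measurableT_comp measurable_fst measurable_fst).
apply: measurable_addC; last exact: mtnth.
apply: measurable_addC => //.
apply: measurable_fun_complex => /=.
- under eq_fun do rewrite mulr0 subr0.
  apply: measurable_funM => //; apply: measurableT_comp m2.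
  by apply: continuous_measurable_fun; exact: continuous_cos.
- under eq_fun do rewrite mulr0 add0r.
  apply: measurable_funM => //; apply: measurableT_comp m2.
  by apply: continuous_measurable_fun; exact: continuous_sin.
Qed.

Let error_eventE w :
  error_event ml_code w = ~` (out w @^-1` (ml_decode @^-1` [set w])).
Proof. by apply/seteqP; split=> -[[s t] z]. Qed.

Let measurable_error w : measurable (error_event ml_code w).
Proof.
rewrite error_eventE; apply: measurableC; rewrite -[X in measurable X]setTI.
by apply: measurable_out => //; exact: measurable_ml_decode.
Qed.

(** Union and Chernoff bounds at once: an error forces some [v] to have a metric no larger than that
    of [w]. Its ratio alone is at least 1, and the other terms are nonnegative. *)
Let error_indic_le w o :
  \1_(error_event ml_code w) o <= \sum_(v < M | v != w) lr w v o.
Proof.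
have lr0 v : 0 <= lr w v o by rewrite lrE expR_ge0.
rewrite indicE; case: (boolP (o \in _)) => [|_]; last by rewrite sumr_ge0.
rewrite inE error_eventE /= => err.
have /forallPn[v] : ~~ best w (out w o).
  by apply/negP => /ml_decodeP.
rewrite negb_imply -leNgt => /andP[vw vbest].
rewrite (bigD1 v)//= (@le_trans _ _ (lr w v o))//; last first.
  by rewrite lerDl sumr_ge0.
by rewrite lrE -expR0 ler_expR divr_ge0// subr_ge0.
Qed.

Lemma error_probability_ml_code : (0 < M)%N ->
  (error_probability Q phase ml_code <= (M%:R^-1 * \sum_(w < M) \sum_(v < M | v != w)
    \prod_(j < N) letter_bound Q phase (tnth (X w) j - tnth (X v) j))%:E)%E.
Proof.
move=> M0; rewrite /error_probability /message_mean EFinM.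
rewrite lee_pmul2l//; last by rewrite lte_fin invr_gt0 ltr0n.
rewrite -sumEFin; apply: lee_sum => w _.
rewrite -[X in channel_law _ _ _ X]setIT -integral_indic//.
apply: (@le_trans _ _ (\int[channel_law Q phase N]_o
    \sum_(v < M | v != w) (lr w v o)%:E)%E).
  apply: ge0_le_integral => //.
  - exact/measurable_EFinP/measurable_indic.
  - under eq_fun do rewrite -big_filter.
    by apply: emeasurable_sum => v; exact/measurable_EFinP.
  - by move=> o _; rewrite sumEFin lee_fin.
under eq_integral do rewrite -big_filter.
rewrite ge0_integral_sum//=.
- rewrite big_filter -sumEFin lee_sum// => v _.
  by rewrite integral_likelihood_ratio.
- by move=> v; exact/measurable_EFinP.
- by move=> v o _; rewrite lee_fin lrE expR_ge0.
Qed.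

End maximum_likelihood_code.

(** * Codes over the square grid *)

Section random_coding.
Context {R : realType}.
Variables (P Q L B : R) (K : nat) (phase : probability R R).
Hypotheses (Q_gt0 : 0 < Q) (L_gt0 : 0 < L) (LP : 2 * L ^+ 2 <= P).
Hypothesis K_gt0 : (0 < K)%N.
Hypothesis grid_bound : forall c d y1 y2 : R, c ^+ 2 + d ^+ 2 = 1 ->
  \sum_(p : 'I_K * 'I_K)
    expR (- rotated_form c d (4 * (2 * Q + 1))^-1 4^-1
      (grid L p.1 + y1) (grid L p.2 + y2)) <= K%:R ^+ 2 * B.
Local Open Scope complex_scope.

Let symbol (p : 'I_K * 'I_K) : R[i] := grid L p.1 +i* grid L p.2.

Let letter_bound_ge0 delta : 0 <= letter_bound Q phase delta.
Proof. by rewrite fine_ge0// integral_ge0// => t _; rewrite lee_fin expR_ge0. Qed.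

Let letter_boundN x y : letter_bound Q phase (x - y) = letter_bound Q phase (y - x).
Proof.
congr fine; apply: eq_integral => t _; congr (expR (- _))%:E.
rewrite /letter_form /rotated_form; case: x y => [xr xi] [yr yi] /=.
by ring.
Qed.

(** [grid_bound] holds for each rotation separately, so it survives averaging over any phase law. *)
Let sum_letter_bound z : \sum_p letter_bound Q phase (symbol p - z) <= K%:R ^+ 2 * B.
Proof.
rewrite -lee_fin -sumEFin.
under eq_bigr do rewrite -letter_boundE//.
have mform p : measurable_fun setT
    (fun t => (expR (- letter_form Q (symbol p - z) t))%:E).
  apply/measurable_EFinP/measurableT_comp => //.
  by apply: measurableT_comp => //; exact: measurable_letter_form.
rewrite -ge0_integral_sum//.
apply: (@le_trans _ _ (\int[phase]_t (cst (K%:R ^+ 2 * B)%:E t))%E); last first.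
  rewrite integral_cst//= -[leRHS]mule1 le_eqVlt; apply/orP; left; apply/eqP.
  by congr (_ * _)%E; exact: probability_setT.
apply: ge0_le_integral => //.
- by move=> t _; apply: sume_ge0 => p _; rewrite lee_fin expR_ge0.
- exact: emeasurable_sum.
move=> t _; rewrite sumEFin lee_fin.
apply: le_trans (grid_bound (- complex.Re z) (- complex.Im z) (cos2Dsin2 t)).
rewrite le_eqVlt; apply/orP; left; apply/eqP; apply: eq_bigr => p _.
by rewrite /letter_form; case: (z).
Qed.

(** The greedy codebook is drawn from all words over the grid; the average over messages cancels the
    factor [M] and leaves [M - 1]. *)
Lemma exists_code M N : (0 < M)%N -> exists c : Defs.code M N,
  power_constrained P Q c /\
  (error_probability Q phase c <= ((M%:R - 1) * B ^+ N)%:E)%E.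
Proof.
move=> M0; pose X := {ffun 'I_N -> 'I_K * 'I_K}.
pose psi (x y : X) := \prod_j letter_bound Q phase (symbol (x j) - symbol (y j)).
have psi_sym x y : psi x y = psi y x by apply: eq_bigr => j _.
have psi_sum y : \sum_x psi x y <= #|{: X}|%:R * B ^+ N.
  (* A sum over words of a product over letters is the product of the letter sums, each at most
     [K ^ 2 * B]. *)
  rewrite /psi -(bigA_distr_bigA (fun j p =>
    letter_bound Q phase (symbol p - symbol (y j)))).
  rewrite card_ffun card_prod !card_ord natrX -exprMn natrM -expr2.
  rewrite -[X in _ ^+ X]card_ord -prodr_const.
  by apply: ler_prod => j _; rewrite sum_letter_bound sumr_ge0.
pose x0 : X := [ffun=> (Ordinal K_gt0, Ordinal K_gt0)].
have [c cM] := exists_codebook psi_sym psi_sum x0 M.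
pose Y (w : 'I_M) : N.-tuple R[i] := [tuple symbol (c w j) | j < N].
exists (ml_code Q Y (Ordinal M0)); split.
  apply: power_ml_code => // w j; rewrite tnth_mktuple /abs2/=.
  rewrite sqr_sqrtr ?addr_ge0 ?sqr_ge0//; apply: le_trans LP.
  have := grid_bounds (c w j).1 L_gt0; have := grid_bounds (c w j).2 L_gt0.
  by move: (grid L _) (grid L _) => a b; nra.
apply: le_trans; first exact: error_probability_ml_code.
rewrite lee_fin ler_pdivrMl ?ltr0n// mulrA; apply: le_trans cM.
rewrite le_eqVlt; apply/orP; left; apply/eqP.
apply: eq_bigr => w _; apply: eq_bigr => v _; apply: eq_bigr => j _.
by rewrite !tnth_mktuple.
Qed.

End random_coding.

(** * Achievable rates *)

Section achievability.
Context {R : realType}.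
Implicit Types P Q r L B : R.

Lemma nb_messages_gt0 r N : (0 < nb_messages r N)%N.
Proof.
rewrite absz_gt0 ceil_neq0; apply/orP; right.
by rewrite powR_gt0.
Qed.

(** The [M - 1] of the union bound absorbs the rounding up of the number of messages. *)
Lemma nb_messages_lt r N : (nb_messages r N)%:R - 1 < (2 `^ r) ^+ N :> R.
Proof.
have -> : (2 `^ r) ^+ N = 2 `^ (N%:R * r) :> R.
  by rewrite -powR_mulrn ?powR_ge0// -powRrM mulrC.
rewrite /nb_messages natr_absz ger0_norm; last first.
  by rewrite ceil_ge0 (lt_le_trans _ (powR_ge0 _ _))// ltrN10.
by have := ceilB1_lt (2 `^ (N%:R * r) : R); rewrite intrB.
Qed.

Lemma error_probability_ge0 Q (phase : probability R R) M N (c : Defs.code M N) :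
  (0 <= error_probability Q phase c)%E.
Proof.
rewrite /error_probability /message_mean mule_ge0//.
  by apply: sume_ge0 => w _; exact: measure_ge0.
Qed.

(** Rate 0 means a single message, so the factor [M - 1] vanishes; a one-point grid with the trivial
    bound 1 suffices. This covers nonpositive targets. *)
Lemma achievable0 P Q (phase : probability R R) : 0 < P -> 0 < Q ->
  achievable P Q phase 0.
Proof.
move=> P0 Q0; split => //; pose L := Num.sqrt (P / 2).
have P20 : 0 < P / 2 by rewrite divr_gt0.
have L0 : 0 < L by rewrite sqrtr_gt0.
have LP : 2 * L ^+ 2 <= P by rewrite sqr_sqrtr ?(ltW P20)// mulrC divfK.
have bound (c d y1 y2 : R) : c ^+ 2 + d ^+ 2 = 1 ->
  \sum_(p : 'I_1 * 'I_1)
    expR (- rotated_form c d (4 * (2 * Q + 1))^-1 4^-1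
      (grid L p.1 + y1) (grid L p.2 + y2)) <= 1%:R ^+ 2 * 1.
  move=> _; rewrite expr1n mulr1.
  rewrite [leRHS](_ : _ = \sum_(p : 'I_1 * 'I_1) 1); last first.
    by rewrite sumr_const card_prod card_ord.
  apply: ler_sum => p _; rewrite -[leRHS]expR0 ler_expR oppr_le0 addr_ge0//.
    by rewrite mulr_ge0 ?sqr_ge0// invr_ge0; lra.
  by rewrite mulr_ge0 ?sqr_ge0.
have nb1 N : (nb_messages (0 : R) N)%:R - 1 = 0 :> R.
  by rewrite /nb_messages mulr0 powRr0 ceil1 subrr.
pose c N := cid
  (exists_code phase Q0 L0 LP (ltn0Sn 0) bound N (nb_messages_gt0 0 N)).
have cP N := svalP (c N).
exists (fun N => sval (c N)); split=> [N|]; first by have [] := cP N.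
rewrite (_ : (fun N => _) = cst 0%E); first exact: cvg_cst.
apply/funext => N; apply/eqP; rewrite eq_le error_probability_ge0 andbT.
by have [_ /le_trans] := cP N; apply; rewrite lee_fin nb1 mul0r.
Qed.

Lemma achievable_of_grid_bound P Q (phase : probability R R) r L B K :
  0 <= r -> 0 < Q -> 0 < L -> 2 * L ^+ 2 <= P -> (0 < K)%N -> 0 <= B ->
  2 `^ r * B < 1 ->
  (forall c d y1 y2, c ^+ 2 + d ^+ 2 = 1 ->
    \sum_(p : 'I_K * 'I_K)
      expR (- rotated_form c d (4 * (2 * Q + 1))^-1 4^-1
        (grid L p.1 + y1) (grid L p.2 + y2)) <= K%:R ^+ 2 * B) ->
  achievable P Q phase r.
Proof.
move=> r0 Q0 L0 LP K0 B0 rB bound; split => //.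
pose c N := cid
  (exists_code phase Q0 L0 LP K0 bound N (nb_messages_gt0 r N)).
have cP N := svalP (c N).
exists (fun N => sval (c N)); split=> [N|]; first by have [] := cP N.
have rB0 : 0 <= 2 `^ r * B by rewrite mulr_ge0// powR_ge0.
apply: (@squeeze_cvge _ _ _ _ (cst 0%E) _ (fun N => ((2 `^ r * B) ^+ N)%:E)).
- near=> N; rewrite error_probability_ge0/=.
  have [_ /le_trans] := cP N; apply.
  by rewrite lee_fin exprMn ler_wpM2r ?exprn_ge0// ltW// nb_messages_lt.
- exact: cvg_cst.
- by apply/cvg_EFin; [near=> N|apply: cvg_expr; rewrite ger0_norm].
Unshelve. all: by end_near. Qed.

Lemma capacity_ge P Q (phase : probability R R) r : achievable P Q phase r ->
  (r%:E <= capacity P Q phase)%E.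
Proof. by move=> ar; apply: ereal_sup_ubound; exists r. Qed.

End achievability.

(** * Comparison with the target rate *)

Section numeric.
Context {R : realType}.
Variables P Q alpha : R.
Hypotheses (P_gt0 : 0 < P) (Q_gt0 : 0 < Q) (alpha01 : 0 <= alpha <= 1).

Let rate := 2^-1 * log2 (1 + Q + alpha * P) - 2^-1 * log2 (1 + Q)
    + 2^-1 * log2 ((1 - alpha) * P + 1) - 3.

(** Squaring clears the halves in the rate; 64 is the square of [2 ^ 3], the loss of three bits. *)
Lemma powR_rate : (2 `^ rate) ^+ 2 =
  (1 + Q + alpha * P) / (1 + Q) * ((1 - alpha) * P + 1) / 64.
Proof.
have [P0 Q0 /andP[a0 a1]] := And3 P_gt0 Q_gt0 alpha01.
have ln2 : ln 2 != 0 :> R by rewrite gt_eqF// ln_gt0// ltr1n.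
have aP : 0 <= alpha * P by rewrite mulr_ge0// ltW.
have aP' : 0 <= (1 - alpha) * P by rewrite mulr_ge0 ?subr_ge0// ltW.
have x0 : 0 < 1 + Q + alpha * P by lra.
have y0 : 0 < 1 + Q by lra.
have z0 : 0 < (1 - alpha) * P + 1 by lra.
rewrite /powR gt_eqF//= -expRM_natl /rate /log2.
move: (1 + Q + alpha * P) x0 => x x0; move: (1 + Q) y0 => y y0.
move: ((1 - alpha) * P + 1) z0 => z z0.
have -> : 2 * ((2^-1 * (ln x / ln 2) - 2^-1 * (ln y / ln 2) +
    2^-1 * (ln z / ln 2) - 3) * ln 2) = ln x - ln y + ln z - 6%:R * ln 2.
  by field.
rewrite !expRD !expRN expRM_natl !lnK ?posrE//.
by congr (_ / _); rewrite -natrX.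
Qed.

(** A bound free of [alpha]: the coefficient of [P] is at most 1, and [4 * alpha * (1 - alpha)] is
    at most 1. *)
Lemma powR_rate_le : (2 `^ rate) ^+ 2 * 64 <= 1 + P + P ^+ 2 / (4 * (1 + Q)).
Proof.
have [P0 Q0 /andP[a0 a1]] := And3 P_gt0 Q_gt0 alpha01.
rewrite powR_rate divfK//.
have q0 : 1 + Q != 0 by rewrite gt_eqF//; lra.
have -> : (1 + Q + alpha * P) / (1 + Q) * ((1 - alpha) * P + 1) =
  1 + (alpha / (1 + Q) + (1 - alpha)) * P +
  4 * alpha * (1 - alpha) * (P ^+ 2 / (4 * (1 + Q))) by field.
have le1 : alpha / (1 + Q) + (1 - alpha) <= 1.
  by rewrite -lerBrDr opprB addrCA subrr addr0 ler_pdivrMr ?ler_peMr; lra.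
have le2 : 4 * alpha * (1 - alpha) <= 1.
  by have := sqr_ge0 (2 * alpha - 1); nra.
rewrite lerD// ?lerD// ?ler_piMl// ?(ltW P0)//.
by rewrite divr_ge0 ?sqr_ge0// mulr_ge0//; lra.
Qed.

Lemma achievable_rate (phase : probability R R) : 0 < rate ->
  achievable P Q phase rate.
Proof.
have [P0 Q0] := conj P_gt0 Q_gt0.
move=> rate0; have P20 : 0 < P / 2 by rewrite divr_gt0.
(* With this [L] the corners of the square have energy exactly [P]. *)
have [L [L0 L2]] : exists L : R, 0 < L /\ L ^+ 2 = P / 2.
  by exists (Num.sqrt (P / 2)); rewrite sqrtr_gt0 sqr_sqrtr// ltW.
have LP : 2 * L ^+ 2 <= P by rewrite L2 mulrC divfK.
pose K := Num.bound (20 * L).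
have KL : 20 * L <= K%:R.
  by rewrite ltW// archi_boundP// mulr_ge0// ltW.
have K0 : (0 < K)%N.
  by rewrite -(ltr_nat R) (lt_le_trans _ KL)// mulr_gt0.
set v := 2 `^ rate.
have v1 : 1 < v.
  by rewrite /v /powR gt_eqF// -[ltLHS]expR0 ltr_expR mulr_gt0// ln_gt0// ltr1n.
have v2 : 1 < v ^+ 2 by rewrite expr_gt1// ltW// (lt_trans _ v1).
have q0 : 0 < 4 * (1 + Q) by lra.
have v0 : 0 <= v by lra.
have vP : v ^+ 2 * 64 <= 1 + P + P ^+ 2 / (4 * (1 + Q)) by exact: powR_rate_le.
have A0 : 0 < (4 * (2 * Q + 1))^-1 by rewrite invr_gt0; lra.
have AC : (4 * (2 * Q + 1))^-1 <= 4^-1 by rewrite lef_pV2 ?posrE; lra.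
have lt1 B : 0 <= B -> v ^+ 2 * B ^+ 2 < 1 -> v * B < 1.
  move=> B0; rewrite -exprMn => vB.
  by rewrite -(@ltr_pXn2r _ 2)// ?nnegrE ?mulr_ge0// expr1n.
(* For [P] small against [Q], only the interference-free coordinate is used. *)
have [PQ|PQ] := lerP P (8 * (1 + Q)).
  pose B := 21/20 * (Num.sqrt 2 / (L * Num.sqrt 4^-1)) : R.
  have B0 : 0 <= B by rewrite mulr_ge0// divr_ge0 ?mulr_ge0 ?sqrtr_ge0 ?ltW.
  apply: (@achievable_of_grid_bound _ _ _ _ _ L B K) => //; first exact: ltW.
    apply: lt1 => //.
    have -> : v ^+ 2 * B ^+ 2 = v ^+ 2 * (441/25) / P.
      rewrite /B !exprMn !exprVn exprMn !sqr_sqrtr ?invr_ge0// L2.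
      by field; rewrite gt_eqF.
    rewrite ltr_pdivrMr// mul1r.
    (* Thus [64 v^2] is at most [1 + 3 P]; since [1 < v^2], this gives [21 v^2 < P], and 21 exceeds
       441/25. *)
    have : P ^+ 2 / (4 * (1 + Q)) <= 2 * P by rewrite ler_pdivrMr//; nra.
    by lra.
  by move=> c d y1 y2 cd; exact: rotated_grid_sum_le1.
(* For large [P] both coordinates carry information, and the bound through the determinant is
   used. *)
pose B := (21/20) ^+ 2 / (L ^+ 2 * Num.sqrt ((4 * (2 * Q + 1))^-1 * 4^-1)) : R.
have B0 : 0 <= B by rewrite divr_ge0 ?sqr_ge0// mulr_ge0 ?sqr_ge0 ?sqrtr_ge0.
apply: (@achievable_of_grid_bound _ _ _ _ _ L B K) => //; first exact: ltW.
  apply: lt1 => //.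
  have -> : v ^+ 2 * B ^+ 2 =
      v ^+ 2 * ((21/20) ^+ 4 * 64) * (2 * Q + 1) / P ^+ 2.
    rewrite /B [(_ / (L ^+ 2 * _)) ^+ 2]expr_div_n [(L ^+ 2 * _) ^+ 2]exprMn.
    rewrite sqr_sqrtr ?mulr_ge0 ?(ltW A0)// L2.
    by field; rewrite !gt_eqF//; lra.
  rewrite ltr_pdivrMr ?exprn_gt0// mul1r.
  (* By [q1], [q2] and [q3] the left side is at most [P^2] times 1/32 + 1/4 + 1/2 = 25/32, which
     stays below 1 after multiplication by [(21/20)^4]. *)
  have q1 : v ^+ 2 * 64 * (2 * (1 + Q)) <=
      2 * (1 + Q) + 2 * (1 + Q) * P + P ^+ 2 / 2.
    rewrite (_ : _ + P ^+ 2 / 2 = (1 + P + P ^+ 2 / (4 * (1 + Q))) * (2 * (1 + Q))).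
      by rewrite ler_pM2r//; lra.
    by field; lra.
  have q2 : 2 * (1 + Q) * P <= P ^+ 2 / 4 by nra.
  have q3 : 2 * (1 + Q) <= P ^+ 2 / 32 by nra.
  have q4 : v ^+ 2 * (2 * Q + 1) <= v ^+ 2 * (2 * (1 + Q)).
    by rewrite ler_wpM2l ?sqr_ge0//; lra.
  have P2 : 0 < P ^+ 2 by rewrite exprn_gt0.
  rewrite mulrAC; move: q1 q2 q3 q4 P2.
  by move: (v ^+ 2 * (2 * Q + 1)) => a; lra.
by move=> c d y1 y2 cd; exact: rotated_grid_sum_le2.
Qed.

End numeric.

Theorem theoremV3 (R : realType) (P Q alpha : R) :
  0 < P -> 0 < Q -> 0 <= alpha <= 1 ->
  ((2^-1 * log2 (1 + Q + alpha * P) - 2^-1 * log2 (1 + Q)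
    + 2^-1 * log2 ((1 - alpha) * P + 1) - 3)%:E
   <= capacity P Q uniform_phase)%E.
Proof.
move=> P0 Q0 alpha01; set rate := (X in X%:E).
(* [achievable] demands a nonnegative rate, so a nonpositive target is compared with rate 0. *)
have [rate_gt0|rate_le0] := ltP 0 rate.
  exact/capacity_ge/achievable_rate.
apply: le_trans (capacity_ge (achievable0 uniform_phase P0 Q0)).
by rewrite lee_fin.
Qed.
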